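(* Suppose that $\chi=(P,Q,R)$ is a quadratic vector field on $\mathbb{T}^2$ such that $R$ is not identically zero. Then $\chi$ does not have any singular point on $\mathbb{T}^2$.
   Context: Fix a real number $a>1$ and let $\mathbb{T}^2=\{(x,y,z)\in\mathbb{R}^3:(x^2+y^2-a^2)^2+z^2-1=0\}$. A triple $\chi=(P,Q,R)$ with $P,Q,R\in\mathbb{R}[x,y,z]$ denotes the polynomial vector field $P\frac{\partial}{\partial x}+Q\frac{\partial}{\partial y}+R\frac{\partial}{\partial z}$ in $\mathbb{R}^3$, acting on polynomials as a derivation; its degree is $\max\{\deg P,\deg Q,\deg R\}$, and it is quadratic if its degree is $2$. It is called a vector field on $\mathbb{T}^2$ if $\chi F=KF$ for some $K\in\mathbb{R}[x,y,z]$, where $F=(x^2+y^2-a^2)^2+z^2-1$. A singular point of $\chi$ is a point where $P=Q=R=0$. *)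

(* Defs.v *)
From mathcomp Require Import all_boot all_order all_algebra.
From mathcomp Require Import reals.
From mathcomp Require Import mpoly.
Set Implicit Arguments. Unset Strict Implicit. Unset Printing Implicit Defensive.
Import Order.TTheory GRing.Theory Num.Theory.
Local Open Scope ring_scope.

(* Indices of the coordinates x, y, z. *)
Definition ix : 'I_3 := @Ordinal 3 0 isT.
Definition iy : 'I_3 := @Ordinal 3 1 isT.
Definition iz : 'I_3 := @Ordinal 3 2 isT.

Record vfield (R : realType) := VField {
  vfP : {mpoly R[3]};
  vfQ : {mpoly R[3]};
  vfR : {mpoly R[3]} }.

Definition vf_act (R : realType) (chi : vfield R) (f : {mpoly R[3]}) :
    {mpoly R[3]} :=
  vfP chi * f^`M(ix) + vfQ chi * f^`M(iy) + vfR chi * f^`M(iz).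

(* [msize p] is 1 + the total degree of [p], and 0 when [p = 0]; the zero
   polynomial thus gets degree 0 here, which is harmless for degree 2. *)
Definition mpdeg (R : realType) (p : {mpoly R[3]}) : nat := (msize p).-1.

Definition vf_deg (R : realType) (chi : vfield R) : nat :=
  maxn (mpdeg (vfP chi)) (maxn (mpdeg (vfQ chi)) (mpdeg (vfR chi))).

Definition quadratic (R : realType) (chi : vfield R) : Prop :=
  vf_deg chi = 2%N.

Definition torusF (R : realType) (a : R) : {mpoly R[3]} :=
  ('X_ix ^+ 2 + 'X_iy ^+ 2 - (a ^+ 2)%:MP) ^+ 2 + 'X_iz ^+ 2 - 1.

Definition vf_on_torus (R : realType) (a : R) (chi : vfield R) : Prop :=
  exists K : {mpoly R[3]}, vf_act chi (torusF a) = K * torusF a.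

(* Points of R^3 are given by their coordinate functions ['I_3 -> R], the
   arguments of the evaluation [p.@[v]]. *)
Definition on_torus (R : realType) (a : R) (v : 'I_3 -> R) : Prop :=
  (v ix ^+ 2 + v iy ^+ 2 - a ^+ 2) ^+ 2 + v iz ^+ 2 - 1 = 0.

Definition singular_point (R : realType) (chi : vfield R) (v : 'I_3 -> R) :
    Prop :=
  [/\ (vfP chi).@[v] = 0, (vfQ chi).@[v] = 0 & (vfR chi).@[v] = 0].

(* Main.v *)
(* Put G = x^2 + y^2 - a^2, so that F = G^2 + z^2 - 1 and
   chi F = 4 G (x P + y Q) + 2 z R = K F.  The cofactor K has degree at most 1
   and vanishes on the circle G = z = 0, hence K = 2 h z with h constant.
   Restricting the identity to the cylinder G = 0 and to the z-axis then forces
   R = h (z^2 - 1 - a^2 G), and dividing by 2 G gives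
   2 (x P + y Q) = h z (x^2 + y^2).  At a singular point of the torus, h <> 0
   yields z = 0 or x = y = 0.  In the first case G^2 = 1 and a^2 G = -1,
   in the second a^4 + z^2 = 1; both contradict a > 1. *)
Require Import Defs.
From mathcomp Require Import all_boot all_order all_algebra.
From mathcomp Require Import reals.
From mathcomp Require Import mpoly.
From mathcomp Require Import ring lra zify.
Local Open Scope ring_scope.
Set Implicit Arguments. Unset Strict Implicit. Unset Printing Implicit Defensive.
Import Order.TTheory GRing.Theory Num.Theory.

(** * Degree bounds and derivatives of variables *)

Lemma msizeM_leS (R : idomainType) n (p q : {mpoly R[n]}) (i j : nat) :
  (msize p <= i.+1)%N -> (msize q <= j.+1)%N -> (msize (p * q) <= (i + j).+1)%N.
Proof.
have [->|p0] := eqVneq p 0; first by rewrite mul0r msize0.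
have [->|q0] := eqVneq q 0; first by rewrite mulr0 msize0.
rewrite msizeM //; lia.
Qed.

Lemma msizeD_leW (R : nzRingType) n (p q : {mpoly R[n]}) (i : nat) :
  (msize p <= i)%N -> (msize q <= i)%N -> (msize (p + q) <= i)%N.
Proof.
by move=> hp hq; apply: leq_trans (msizeD_le _ _) _; rewrite geq_max hp.
Qed.

Lemma mderivXU (R : nzRingType) n (i j : 'I_n) :
  ('X_i : {mpoly R[n]})^`M(j) = (i == j)%:R.
Proof.
rewrite mderivX mnm1E; case: eqP => [->|_]; last by rewrite scale0r.
by rewrite scale1r -[X in (X - _)%MM]add0m addmK mpolyX0.
Qed.

Lemma msizeXU_sq (R : nzRingType) n (i : 'I_n) :
  (msize (('X_i : {mpoly R[n]}) ^+ 2) <= 3)%N.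
Proof. by rewrite mpolyXn msizeX mdegMn mdeg1. Qed.

Lemma msizeC_le1 (R : nzRingType) n (b : R) : (msize (b%:MP_[n]) <= 1)%N.
Proof. by rewrite msizeC; case: eqP. Qed.

(** * Coefficients of polynomials of degree at most two *)

Lemma mpolyX3E (R : nzRingType) (m : 'X_{1..3}) :
  'X_[R, m] = 'X_ix ^+ m ix * 'X_iy ^+ m iy * 'X_iz ^+ m iz.
Proof.
rewrite mpolyXE_id !big_ord_recl big_ord0 mulr1 mulrA.
by congr (_ * _ * _); congr ('X_ _ ^+ m _); apply: val_inj.
Qed.

Lemma mdeg3E (m : 'X_{1..3}) : mdeg m = (m ix + m iy + m iz)%N.
Proof.
rewrite mdegE !big_ord_recl big_ord0 addn0 addnA.
by congr (m _ + m _ + m _)%N; apply: val_inj.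
Qed.

(** The terms are ordered by degree, so the indices above 3 are exactly those of the degree two
    terms. *)
Definition quad_mpoly (R : comNzRingType) (c : nat -> R) : {mpoly R[3]} :=
  (c 0%N)%:MP + (c 1%N)%:MP * 'X_ix + (c 2%N)%:MP * 'X_iy + (c 3%N)%:MP * 'X_iz
  + (c 4%N)%:MP * 'X_ix ^+ 2 + (c 5%N)%:MP * 'X_iy ^+ 2
  + (c 6%N)%:MP * 'X_iz ^+ 2 + (c 7%N)%:MP * ('X_ix * 'X_iy)
  + (c 8%N)%:MP * ('X_ix * 'X_iz) + (c 9%N)%:MP * ('X_iy * 'X_iz).

Lemma quad_mpolyD (R : comNzRingType) (c d : nat -> R) :
  quad_mpoly c + quad_mpoly d = quad_mpoly (fun i => c i + d i).
Proof. rewrite /quad_mpoly; ring. Qed.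

Lemma quad_mpolyZ (R : comNzRingType) (b : R) (c : nat -> R) :
  b *: quad_mpoly c = quad_mpoly (fun i => b * c i).
Proof. rewrite /quad_mpoly -mul_mpolyC; ring. Qed.

Lemma quad_mpoly_delta (R : comNzRingType) (m : 'X_{1..3}) : (mdeg m < 3)%N ->
  exists2 j : nat, 'X_[R, m] = quad_mpoly (fun i => (i == j)%:R)
    & ((1 < mdeg m)%N = (3 < j)%N).
Proof.
rewrite mdeg3E mpolyX3E /quad_mpoly.
move: (m ix) (m iy) (m iz) => [|[|[|i]]] [|[|[|j]]] [|[|[|k]]] //= hm; try lia.
- by exists 0%N => //=; ring.
- by exists 3%N => //=; ring.
- by exists 6%N => //=; ring.
- by exists 2%N => //=; ring.
- by exists 9%N => //=; ring.
- by exists 5%N => //=; ring.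
- by exists 1%N => //=; ring.
- by exists 8%N => //=; ring.
- by exists 7%N => //=; ring.
- by exists 4%N => //=; ring.
Qed.

Lemma msize_le3_quad (R : comNzRingType) (p : {mpoly R[3]}) :
  (msize p <= 3)%N -> exists2 c : nat -> R, p = quad_mpoly c
    & (msize p <= 2)%N -> forall i, (3 < i)%N -> c i = 0.
Proof.
(* Only the first [p] is expanded: the premise [msize p <= 2] keeps speaking of the whole polynomial
   and so bounds every monomial of its support. *)
move=> hp; rewrite {1}[p]mpolyE big_seq.
elim/big_ind: _ => [|q r [c -> hc] [d -> hd]|m mp].
- by exists (fun=> 0) => //; rewrite /quad_mpoly; ring.
- exists (fun i => c i + d i); first by rewrite quad_mpolyD.
  by move=> h i hi; rewrite hc // hd // addr0.
- have [j -> hj] := quad_mpoly_delta R (leq_trans (msize_mdeg_lt mp) hp).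
  exists (fun i => p@_m * (i == j)%:R); first by rewrite quad_mpolyZ.
  move=> h i hi; have hm := leq_trans (msize_mdeg_lt mp) h.
  case: eqP => [ij|_]; rewrite ?mulr0 //.
  by move: hj; rewrite -ij hi; lia.
Qed.

Lemma msize_le2_affine (R : comNzRingType) (p : {mpoly R[3]}) :
  (msize p <= 2)%N -> exists c : nat -> R, p = (c 0%N)%:MP
    + (c 1%N)%:MP * 'X_ix + (c 2%N)%:MP * 'X_iy + (c 3%N)%:MP * 'X_iz.
Proof.
move=> hp; have [c pE /(_ hp) hc] := msize_le3_quad (leqW hp); exists c.
rewrite pE /quad_mpoly (hc 4%N) // (hc 5%N) // (hc 6%N) // (hc 7%N) //.
by rewrite (hc 8%N) // (hc 9%N) //; ring.
Qed.

Definition pt3 (R : nzRingType) (x y z : R) (i : 'I_3) : R :=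
  nth 0 [:: x; y; z] i.

Definition mevalE3 :=
  (mevalD, mevalM, mevalB, mevalN, mevalC, mevalXU, rmorphXn, rmorph1).

(** * The torus and the cofactor of a quadratic field *)

Section Torus.
Variables (R : realType) (a : R).

Definition torusG : {mpoly R[3]} := 'X_ix ^+ 2 + 'X_iy ^+ 2 - (a ^+ 2)%:MP.

Lemma torusFE : torusF a = torusG ^+ 2 + 'X_iz ^+ 2 - 1.
Proof. by []. Qed.

Lemma vf_act_torusF (chi : vfield R) :
  vf_act chi (torusF a) =
  4%:R * torusG * ('X_ix * vfP chi + 'X_iy * vfQ chi)
  + 2%:R * 'X_iz * vfR chi.
Proof.
rewrite /vf_act /torusF /torusG !expr2 -[1]/(1%:MP).
rewrite !(mderivD, mderivM, mderivN, mderivC, mderivXU, mderivB) /=.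
ring.
Qed.

Lemma msize_torusG : msize torusG = 3%N.
Proof.
apply/eqP; rewrite eqn_leq; apply/andP; split.
  rewrite /torusG -mpolyCN.
  do 2?apply: msizeD_leW; rewrite ?msizeXU_sq //.
  exact: leq_trans (msizeC_le1 _ _) _.
rewrite ltnNge; apply/negP => h.
have [c e] := msize_le2_affine h.
(* An affine function has at 0 the mean of its values at 1 and -1; $x^2-a^2$ does not. *)
have ev x := congr1 (meval (pt3 x 0 0)) e.
move: (ev 0) (ev 1) (ev (-1)).
by rewrite /torusG !mevalE3 /pt3 /=; lra.
Qed.

Lemma torusG_neq0 : torusG != 0.
Proof. by apply/eqP => h; move: msize_torusG; rewrite h msize0. Qed.

(** $G^2$ has degree 4, and $z^2-1$ is too small to cancel its leading part. *)
Lemma msize_torusF : (4 < msize (torusF a))%N.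
Proof.
rewrite ltnNge; apply/negP => h.
have e : torusG ^+ 2 = torusF a - 'X_iz ^+ 2 + 1%:MP.
  by rewrite torusFE mpolyC1; ring.
have : (msize (torusG ^+ 2) <= 4)%N.
  rewrite e; apply: msizeD_leW; last exact: leq_trans (msizeC_le1 _ _) _.
  by apply: msizeD_leW => //; rewrite msizeN (leq_trans (msizeXU_sq _ _)).
by rewrite expr2 msizeM ?torusG_neq0 // msize_torusG.
Qed.

Lemma quadratic_msize (chi : vfield R) : quadratic chi ->
  [/\ (msize (vfP chi) <= 3)%N, (msize (vfQ chi) <= 3)%N
    & (msize (vfR chi) <= 3)%N].
Proof. rewrite /quadratic /vf_deg /mpdeg => h; split; lia. Qed.

(** $\chi F$ has degree at most 5 and $F$ at least 4, and degrees add over a domain. *)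
Lemma msize_cofactor (chi : vfield R) (K : {mpoly R[3]}) : quadratic chi ->
  vf_act chi (torusF a) = K * torusF a -> (msize K <= 2)%N.
Proof.
move=> /quadratic_msize [hP hQ hR] e.
have [->|K0] := eqVneq K 0; first by rewrite msize0.
have F0 : torusF a != 0.
  by apply/eqP => h; move: msize_torusF; rewrite h msize0.
have hX i : (msize ('X_i : {mpoly R[3]}) <= 2)%N by rewrite msizeX mdeg1.
have hn n : (msize (n%:R : {mpoly R[3]}) <= 1)%N.
  by rewrite -mpolyC_nat msizeC_le1.
have : (msize (K * torusF a) <= 6)%N.
  rewrite -e vf_act_torusF; apply: msizeD_leW.
    apply: (@msizeM_leS _ _ _ _ 2 3).
      by apply: (@msizeM_leS _ _ _ _ 0 2); rewrite ?hn ?msize_torusG.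
    by apply: msizeD_leW; apply: (@msizeM_leS _ _ _ _ 1 2).
  apply: (@leq_trans 4) => //; apply: (@msizeM_leS _ _ _ _ 1 2) => //.
  exact: (@msizeM_leS _ _ _ _ 0 1).
rewrite msizeM //; move: msize_torusF.
move: (mmeasure _ K) (mmeasure _ (torusF a)) => i j; lia.
Qed.

Lemma quadratic_vf_cofactor (chi : vfield R) (K : {mpoly R[3]}) : a != 0 ->
  quadratic chi -> vf_act chi (torusF a) = K * torusF a ->
  exists h : R, K = (2%:R * h)%:MP * 'X_iz /\
    vfR chi = h%:MP * ('X_iz ^+ 2 - 1 - (a ^+ 2)%:MP * torusG).
Proof.
move=> a0 hq e; have hK := msize_cofactor hq e.
have [_ _ hR] := quadratic_msize hq.
have [c Rc _] := msize_le3_quad hR.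
have [d Kd] := msize_le2_affine hK.
(* [P] and [Q] stay unexpanded: the points chosen below all have $G=0$ or $x=y=0$, where their term
   drops out. *)
have ev x y z :
    4 * (x ^+ 2 + y ^+ 2 - a ^+ 2) *
      (x * (vfP chi).@[pt3 x y z] + y * (vfQ chi).@[pt3 x y z])
    + 2 * z * (c 0%N + c 1%N * x + c 2%N * y + c 3%N * z + c 4%N * x ^+ 2
      + c 5%N * y ^+ 2 + c 6%N * z ^+ 2
      + c 7%N * (x * y) + c 8%N * (x * z) + c 9%N * (y * z))
    = (d 0%N + d 1%N * x + d 2%N * y + d 3%N * z)
      * ((x ^+ 2 + y ^+ 2 - a ^+ 2) ^+ 2 + z ^+ 2 - 1).
  have := congr1 (meval (pt3 x y z)) e.
  rewrite vf_act_torusF torusFE /torusG -!mpolyC_nat -mpolyC1 Rc Kd /quad_mpoly.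
  by rewrite !mevalE3 /pt3 /=.
(* At $(\pm a,0,0)$ and $(0,a,0)$ the left side is 0 while $F=-1$, so $K$ vanishes there. *)
have d1 : d 1%N = 0.
  apply: (mulIf a0); move: (ev a 0 0) (ev (- a) 0 0); lra.
have d0 : d 0%N = 0 by move: (ev a 0 0) (ev (- a) 0 0); lra.
have d2 : d 2%N = 0.
  by apply: (mulIf a0); move: (ev 0 a 0); lra.
pose h := d 3%N / 2; have d3 : d 3%N = 2 * h by rewrite /h; field.
exists h; split.
  by rewrite Kd d0 d1 d2 d3; ring.
move: ev; rewrite d0 d1 d2 d3 => {Kd d0 d1 d2 d3 e} ev.
(* On the z-axis, division by $2z$ leaves $c_0+c_3z+c_6z^2=h(a^4+z^2-1)$; three nonzero values of
   $z$ determine it. *)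
have [c0 c3 c6] : [/\ c 0%N = h * (a ^+ 4 - 1), c 3%N = 0 & c 6%N = h].
  by move: (ev 0 0 1) (ev 0 0 (-1)) (ev 0 0 2) => *; split; lra.
have a20 : a ^+ 2 != 0 by rewrite expf_neq0.
(* With $G=0$ and $z=\pm1$ also $F=0$, so the third component vanishes at these points; the sign
   choices separate the coefficients. *)
have [c1 c8 c4] : [/\ c 1%N = 0, c 8%N = 0 & c 4%N = - h * a ^+ 2].
  move: (ev a 0 1) (ev a 0 (-1)) (ev (- a) 0 1) (ev (- a) 0 (-1)).
  rewrite c0 c3 c6 => *.
  by split; [apply: (mulIf a0)|apply: (mulIf a0)|apply: (mulIf a20)]; lra.
have [c2 c9 c5] : [/\ c 2%N = 0, c 9%N = 0 & c 5%N = - h * a ^+ 2].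
  move: (ev 0 a 1) (ev 0 a (-1)) (ev 0 (- a) 1) (ev 0 (- a) (-1)).
  rewrite c0 c3 c6 => *.
  by split; [apply: (mulIf a0)|apply: (mulIf a0)|apply: (mulIf a20)]; lra.
(* The triple 3, 4, 5 gives a point of the circle $x^2+y^2=a^2$ with $xy\neq0$, which isolates the
   last coefficient. *)
have c7 : c 7%N = 0.
  apply: (mulIf a20); move: (ev (3 / 5 * a) (4 / 5 * a) 1).
  by rewrite c0 c1 c2 c3 c4 c5 c6 c8 c9; lra.
by rewrite Rc /quad_mpoly c0 c1 c2 c3 c4 c5 c6 c7 c8 c9 /torusG; ring.
Qed.

(* The polynomial identity is divided by [torusG], which is not possible
   pointwise on the cylinder where [torusG] vanishes. *)
Lemma quadratic_vf_radial (chi : vfield R) (h : R) :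
  vf_act chi (torusF a) = (2%:R * h)%:MP * 'X_iz * torusF a ->
  vfR chi = h%:MP * ('X_iz ^+ 2 - 1 - (a ^+ 2)%:MP * torusG) ->
  2%:R * ('X_ix * vfP chi + 'X_iy * vfQ chi)
    = h%:MP * 'X_iz * ('X_ix ^+ 2 + 'X_iy ^+ 2).
Proof.
rewrite vf_act_torusF torusFE => e eR.
have G20 : 2%:R * torusG != 0.
  by rewrite mulf_neq0 ?torusG_neq0 // -mpolyC_nat mpolyC_eq0 pnatr_eq0.
apply: (mulfI G20).
(* Moving $2zR$ to the right leaves $4G(xP+yQ)=2hzG(G+a^2)$. *)
have -> : 'X_ix ^+ 2 + 'X_iy ^+ 2 = torusG + (a ^+ 2)%:MP.
  by rewrite /torusG subrK.
move: e; rewrite eR => /(canRL (addrK _)) e.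
rewrite [LHS](_ : _ =
  4%:R * torusG * ('X_ix * vfP chi + 'X_iy * vfQ chi)); last by ring.
by rewrite e; ring.
Qed.

End Torus.

Theorem theorem2p7 (R : realType) (a : R) (ha : 1 < a) (chi : vfield R)
  (hquad : quadratic chi) (htorus : vf_on_torus a chi)
  (hR : vfR chi <> 0) :
  ~ (exists v : 'I_3 -> R, on_torus a v /\ singular_point chi v).
Proof.
have a0 : a != 0 by lra.
case: htorus => K e [v [tv [Pv Qv Rv]]].
have [h [Kh eR]] := quadratic_vf_cofactor a0 hquad e.
have eW : 2%:R * ('X_ix * vfP chi + 'X_iy * vfQ chi)
    = h%:MP * 'X_iz * ('X_ix ^+ 2 + 'X_iy ^+ 2).
  by apply: (quadratic_vf_radial (a := a)); rewrite -?Kh.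
have h0 : h != 0.
  by apply/eqP => h0; apply: hR; rewrite eR h0 mpolyC0 mul0r.
have := congr1 (meval v) eW; rewrite -mpolyC_nat !mevalE3 /= Pv Qv.
have := congr1 (meval v) eR; rewrite -mpolyC1 /torusG !mevalE3 /= Rv.
move: tv; rewrite /on_torus.
set x := v ix; set y := v iy; set z := v iz => tv eRv eWv.
have a2 : 1 < a ^+ 2 by nra.
have {}eRv : z ^+ 2 - 1 - a ^+ 2 * (x ^+ 2 + y ^+ 2 - a ^+ 2) = 0.
  by apply: (mulfI h0); rewrite mulr0 -eRv; ring.
have /eqP : z * (x ^+ 2 + y ^+ 2) = 0.
  by apply: (mulfI h0); rewrite mulr0 mulrA -eWv; ring.
rewrite mulf_eq0 => /orP[/eqP z0|/eqP r0].
  (* Squaring $a^2G=-1$ and using $G^2=1$ gives $a^4=1$, against $a^2>1$. *)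
  move: tv eRv; rewrite z0; set G := _ - a ^+ 2 => tv eRv.
  have G2 : G ^+ 2 = 1 by lra.
  have aG : a ^+ 2 * G = -1 by lra.
  have : (a ^+ 2) ^+ 2 * G ^+ 2 = 1 by rewrite -exprMn aG; ring.
  by rewrite G2; nra.
by move: tv; rewrite r0; nra.
Qed.
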